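(* Let $(A_{1},k_{1})\subseteq(A_{2},k_{2})$ and $(B_{1},l_{1})\subseteq(B_{2},l_{2})$ be two extensions of Cohen rings, and suppose that $k_{2}/k_{1}$ is separable. Let $\phi=(\phi_{A},\phi_{k}):(A_{1},k_{1})\to(B_{1},l_{1})$ be a morphism, and let $\Phi_{k}:k_{2}\to l_{2}$ be a field embedding extending $\phi_{k}$ such that $l_{2}/\Phi_{k}(k_{2})$ is separable. Let $\boldsymbol{\beta}$ be a $p$-basis of $k_{2}$ over $k_{1}$, and let $s_{A}:\boldsymbol{\beta}\to A_{2}$ and $s_{B}:\Phi_{k}(\boldsymbol{\beta})\to B_{2}$ be choices of representatives. Then there exists a unique morphism of Cohen rings $\Phi=(\Phi_{A},\Phi_{k}):(A_{2},k_{2})\to(B_{2},l_{2})$ whose residue field component is the given $\Phi_k$, which respects $s_{A}$ and $s_{B}$ (i.e. $\Phi_A(s_A(\beta))=s_B(\Phi_k(\beta))$ for all $\beta\in\boldsymbol\beta$), and which extends $\phi$ (i.e. $\Phi_A|_{A_1}=\phi_A$).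
   Context: $p$ is a fixed prime. A Cohen ring is a pair $(A,k)$ where $A$ is a commutative Noetherian local ring, complete in its local ($\mathfrak m$-adic) topology, with maximal ideal $\mathfrak m_A=pA$, and $k=A/\mathfrak m_A$ with residue map $\mathrm{res}$. A morphism $(A,k)\to(B,l)$ of such rings is a pair $(\phi_A,\phi_k)$ of ring homomorphisms $\phi_A:A\to B$, $\phi_k:k\to l$ with $\phi_A^{-1}(\mathfrak m_B)=\mathfrak m_A$ and $\phi_k\circ\mathrm{res}=\mathrm{res}\circ\phi_A$. We write $(A_1,k_1)\subseteq(A_2,k_2)$ if $A_1$ is a subring of $A_2$, $k_1$ a subfield of $k_2$, and the inclusions form a morphism. A subset $\boldsymbol\beta\subseteq k_2$ is a $p$-basis of $k_2$ over $k_1$ if $k_2=k_2^p k_1(\boldsymbol\beta)$ and $[k_2^pk_1(\beta_1,\dots,\beta_r):k_2^pk_1]=p^r$ for all pairwise distinct $\beta_1,\dots,\beta_r\in\boldsymbol\beta$ (equivalently, when $k_2/k_1$ is separable, $\boldsymbol\beta$ together with any $p$-basis of $k_1$ is a $p$-basis of $k_2$, disjointly). A choice of representatives $s:X\to A$ for a subset $X$ of the residue field satisfies $\mathrm{res}(s(x))=x$. *)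

(* Defs.v *)
From HB Require Import structures.
From mathcomp Require Import all_boot all_order all_algebra.
Set Implicit Arguments. Unset Strict Implicit. Unset Printing Implicit Defensive.
Import Order.TTheory GRing.Theory.
Local Open Scope ring_scope.

Definition ring_hom (R S : comPzRingType) (f : R -> S) : Prop :=
  f 1 = 1 /\ (forall x y, f (x + y) = f x + f y) /\ (forall x y, f (x * y) = f x * f y).

Definition pdivn (p : nat) (A : comPzRingType) (n : nat) (a : A) : Prop :=
  exists b : A, a = (p%:R) ^+ n * b.

Definition in_pA (p : nat) (A : comPzRingType) (a : A) : Prop := pdivn p 1 a.

Definition is_ideal (A : comPzRingType) (I : A -> Prop) : Prop :=
  I 0 /\ (forall x y, I x -> I y -> I (x + y)) /\ (forall r x, I x -> I (r * x)).

Definition fin_gen_ideal (A : comPzRingType) (I : A -> Prop) : Prop :=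
  exists (n : nat) (g : 'I_n -> A),
    forall x, I x <-> exists c : 'I_n -> A, x = \sum_(i < n) c i * g i.

Definition noetherian (A : comPzRingType) : Prop :=
  forall I : A -> Prop, is_ideal I -> fin_gen_ideal I.

(* res : A -> k is a surjective ring map onto a field with kernel pA, and every
   element outside pA is a unit: so A is local with maximal ideal pA and
   k = A / pA. *)
Definition local_pA (p : nat) (A : comPzRingType) : Prop :=
  forall a : A, ~ in_pA p a -> exists b : A, a * b = 1.

Definition padic_separated (p : nat) (A : comPzRingType) : Prop :=
  forall a : A, (forall n, pdivn p n a) -> a = 0.

Definition padic_complete (p : nat) (A : comPzRingType) : Prop :=
  forall u : nat -> A,
    (forall n, exists N, forall i j, (N <= i)%N -> (N <= j)%N -> pdivn p n (u i - u j)) ->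
    exists x : A, forall n, exists N, forall i, (N <= i)%N -> pdivn p n (u i - x).

Definition is_cohen_ring (p : nat) (A : comPzRingType) (k : fieldType) (res : A -> k) : Prop :=
  ring_hom (res : A -> k) /\
  [/\ (forall y : k, exists a : A, res a = y),
      (forall a : A, res a = 0 <-> in_pA p a),
      local_pA p A,
      noetherian A &
      padic_separated p A /\ padic_complete p A].

Definition is_cohen_morphism (p : nat) (A : comPzRingType) (k : fieldType) (resA : A -> k)
  (B : comPzRingType) (l : fieldType) (resB : B -> l)
  (phiA : A -> B) (phik : k -> l) : Prop :=
  [/\ ring_hom phiA, ring_hom (phik : k -> l),
      (forall a : A, in_pA p (phiA a) <-> in_pA p a) &
      (forall a : A, phik (resA a) = resB (phiA a))].

(* (A1,k1) ⊆ (A2,k2): the subring / subfield inclusions are modelled by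
   injective maps iA, ik forming a morphism of Cohen rings. *)
Definition is_cohen_ext (p : nat) (A1 : comPzRingType) (k1 : fieldType) (res1 : A1 -> k1)
  (A2 : comPzRingType) (k2 : fieldType) (res2 : A2 -> k2)
  (iA : A1 -> A2) (ik : k1 -> k2) : Prop :=
  [/\ is_cohen_ring p res1, is_cohen_ring p res2,
      injective iA, injective ik &
      is_cohen_morphism p res1 res2 iA ik].

Definition is_subfield (K : fieldType) (S : K -> Prop) : Prop :=
  S 0 /\ S 1 /\ forall x y, S x -> S y ->
    [/\ S (x + y), S (- x), S (x * y) & S (x^-1)].

Definition gen_subfield (K : fieldType) (G : K -> Prop) : K -> Prop :=
  fun x => forall S : K -> Prop, is_subfield S -> (forall y, G y -> S y) -> S x.

Definition lin_indep_over (K : fieldType) (F : K -> Prop) (n : nat) (v : 'I_n -> K) : Prop :=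
  forall c : 'I_n -> K, (forall i, F (c i)) -> \sum_(i < n) c i * v i = 0 -> forall i, c i = 0.

Definition ext_degree_is (K : fieldType) (F E : K -> Prop) (n : nat) : Prop :=
  exists v : 'I_n -> K,
    [/\ (forall i, E (v i)), lin_indep_over F v &
        (forall x, E x -> exists c : 'I_n -> K,
           (forall i, F (c i)) /\ x = \sum_(i < n) c i * v i)].

Definition pth_powers (p : nat) (K : fieldType) : K -> Prop :=
  fun x => exists y : K, x = y ^+ p.

Definition pK1 (p : nat) (K1 K2 : fieldType) (ik : K1 -> K2) : K2 -> Prop :=
  gen_subfield (fun x => pth_powers p x \/ exists y, x = ik y).

Definition pK1_adj (p : nat) (K1 K2 : fieldType) (ik : K1 -> K2) (G : K2 -> Prop) : K2 -> Prop :=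
  gen_subfield (fun x => (pth_powers p x \/ exists y, x = ik y) \/ G x).

Definition is_p_basis (p : nat) (K1 K2 : fieldType) (ik : K1 -> K2) (beta : K2 -> Prop) : Prop :=
  (forall x : K2, pK1_adj p ik beta x) /\
  (forall (r : nat) (b : 'I_r -> K2), injective b -> (forall i, beta (b i)) ->
     ext_degree_is (pK1 p ik) (pK1_adj p ik (fun x => exists i, x = b i)) (p ^ r)%N).

(* Separability of an arbitrary extension K2/K1 of fields of characteristic p
   (K1 embedded via ik): K2 is linearly disjoint from K1^{1/p} over K1;
   after applying Frobenius: elements of K1 linearly independent over K1^p
   remain linearly independent over K2^p. *)
Definition separable_ext (p : nat) (K1 K2 : fieldType) (ik : K1 -> K2) : Prop :=
  forall (n : nat) (x : 'I_n -> K1),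
    lin_indep_over (pth_powers p (K := K1)) x ->
    lin_indep_over (pth_powers p (K := K2)) (fun i => ik (x i)).

(* Main.v *)
Require Import Defs.
From HB Require Import structures.
From mathcomp Require Import all_boot all_order all_algebra.
From mathcomp Require Import boolp.
From mathcomp Require Import ring.
Set Implicit Arguments. Unset Strict Implicit. Unset Printing Implicit Defensive.
Import GRing.Theory.
Local Open Scope ring_scope.

(** Let [T] be the subring of [A2 * B2] of the pairs whose residues correspond
    under [Phik], and [M] the multiplicative monoid generated by the pairs
    [(iA a, jB (phiA a))] and [(sA b, sB (Phik b))].  Put [R_0 = T] and let
    [R_(n+1)] consist of the [\sum_j m_j * r_j ^+ p + p * r] with [m_j] in [M]
    and [r_j], [r] in [R_n]; this is a decreasing sequence of subrings.

    As [k2] is generated by [k1], [beta] and the [p]-th powers, every [R_n]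
    projects onto [A2].  By separability and [p]-independence of [beta],
    finitely many elements of [M] can be written as [\sum_v E_v * c_v ^+ p]
    modulo [p], where the residues of the [E_v] are independent over [k2^p].
    Hence an element of [R_(n+1)] with residue [0] lies in [p * R_n], and by
    induction an element of [R_n] whose first component is divisible by
    [p^(n+1)] has its second component divisible by [p^(n+1)].  So the [R_n]
    converge to the graph of a ring morphism [A2 -> B2].  Conversely any
    admissible morphism has its graph within [p^(n+1)] of [R_n], because [p]-th
    powers of elements congruent modulo [p^(n+1)] are congruent modulo
    [p^(n+2)]. *)

(** * Bundled morphisms and subrings given by predicates *)

Lemma ring_hom_rmorphism (R S : comPzRingType) (f : R -> S) :
  ring_hom f -> exists g : {rmorphism R -> S}, f = g.
Proof.
move=> [f1 [fD fM]].
have f0 : f 0 = 0 by apply: (@addrI _ (f 0)); rewrite -fD !addr0.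
have fB : GRing.zmod_morphism f.
  move=> x y; have fN : f (- y) = - f y.
    by apply/eqP; rewrite -addr_eq0 -fD addNr f0.
  by rewrite fD fN.
pose H1 := GRing.isZmodMorphism.Build _ _ f fB.
pose H2 := GRing.isMonoidMorphism.Build _ _ f (conj f1 fM).
pose g : {rmorphism R -> S} := HB.pack f H1 H2.
by exists g.
Qed.

Definition is_subring (R : comPzRingType) (P : R -> Prop) : Prop :=
  [/\ P 1, (forall x y, P x -> P y -> P (x - y)) &
      (forall x y, P x -> P y -> P (x * y))].

Section Subring.
Variables (R : comPzRingType) (P : R -> Prop).
Hypothesis subP : is_subring P.

Lemma subring0 : P 0.
Proof. by case: subP => P1 PB _; rewrite -(subrr 1); apply: PB. Qed.

Lemma subringN x : P x -> P (- x).
Proof. by case: subP => _ PB _ Px; rewrite -sub0r; apply: PB => //; apply: subring0. Qed.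

Lemma subringD x y : P x -> P y -> P (x + y).
Proof.
by case: subP => _ PB _ Px Py; rewrite -(opprK y); apply/PB/subringN.
Qed.

Lemma subringM x y : P x -> P y -> P (x * y).
Proof. by case: subP => _ _; apply. Qed.

Lemma subringX x n : P x -> P (x ^+ n).
Proof.
move=> Px; elim: n => [|n IH]; first by case: subP.
by rewrite exprS; apply: subringM.
Qed.

Lemma subring_nat n : P n%:R.
Proof.
elim: n => [|n IH]; first exact: subring0.
by rewrite mulrSr; apply: subringD IH _; case: subP.
Qed.

Lemma subring_sum (I : Type) (s : seq I) (Q : pred I) (F : I -> R) :
  (forall i, Q i -> P (F i)) -> P (\sum_(i <- s | Q i) F i).
Proof. by move=> PF; apply: big_ind => //; [apply: subring0|apply: subringD]. Qed.

Lemma subring_sum_seq (I : eqType) (s : seq I) (F : I -> R) :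
  (forall i, i \in s -> P (F i)) -> P (\sum_(i <- s) F i).
Proof. by move=> PF; rewrite big_seq; apply: subring_sum. Qed.

(** The quotient must lie in [P], not merely in [R]: dividing by [p] has to stay inside a level of
    the tower. *)
Definition mult_of (p : nat) (z : R) : Prop := exists2 r, P r & z = p%:R * r.

Lemma mult_of0 p : mult_of p 0.
Proof. by exists 0; [apply: subring0 | rewrite mulr0]. Qed.

Lemma mult_ofD p x y : mult_of p x -> mult_of p y -> mult_of p (x + y).
Proof.
by move=> [r Pr ->] [s Ps ->]; exists (r + s); [apply: subringD|rewrite mulrDr].
Qed.

Lemma mult_ofN p x : mult_of p x -> mult_of p (- x).
Proof. by move=> [r Pr ->]; exists (- r); [apply: subringN|rewrite mulrN]. Qed.

Lemma mult_ofM p x y : P x -> mult_of p y -> mult_of p (x * y).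
Proof.
by move=> Px [r Pr ->]; exists (x * r); [apply: subringM|rewrite mulrCA].
Qed.

Lemma mult_of_sum p (I : Type) (s : seq I) (Q : pred I) (F : I -> R) :
  (forall i, Q i -> mult_of p (F i)) -> mult_of p (\sum_(i <- s | Q i) F i).
Proof. by move=> PF; apply: big_ind => //; [apply: mult_of0|apply: mult_ofD]. Qed.

(** The inner binomial coefficients are divisible by [p], and the quotient is an integer polynomial
    in [x] and [y], so it stays in [P]. *)
Lemma prime_expD_mult_of p x y : prime p -> P x -> P y ->
  mult_of p (x ^+ p + y ^+ p - (x + y) ^+ p).
Proof.
move=> pr_p Px Py; have p_gt0 := prime_gt0 pr_p.
rewrite exprDn -(prednK p_gt0) big_ord_recl big_ord_recr /= (prednK p_gt0).
rewrite subn0 expr0 mulr1 bin0 mulr1n /bump leq0n add1n (prednK p_gt0).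
rewrite subnn expr0 mul1r binn mulr1n.
set s := \sum_(i < _) _.
have -> : x ^+ p + y ^+ p - (x ^+ p + (s + y ^+ p)) = - s by ring.
apply: mult_ofN; apply: mult_of_sum => i _.
have /dvdnP[c ->] : (p %| 'C(p, i.+1))%N.
  by apply: prime_dvd_bin => //=; rewrite -[X in (_ < X)%N](prednK p_gt0) ltnS ltn_ord.
rewrite -mulr_natl natrM -mulrA mulrCA.
eexists; last reflexivity.
by do !apply: subringM; [apply: subring_nat| |]; apply: subringX.
Qed.

End Subring.

(** * The decreasing tower of subrings *)

Section Tower.
Variables (p : nat) (R : comPzRingType).
Hypothesis pr_p : prime p.
Implicit Types (M P : R -> Prop).

Definition frob_step M P (z : R) : Prop :=
  exists (s : seq (R * R)) (r : R),
    [/\ (forall x, x \in s -> M x.1 /\ P x.2), P r &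
        z = \sum_(x <- s) x.1 * x.2 ^+ p + p%:R * r].

(** Closure under negation lets plain lists of products [m * r ^+ p] represent all their integer
    combinations. *)
Definition is_signed_monoid M : Prop :=
  [/\ M 1, (forall x, M x -> M (- x)) & (forall x y, M x -> M y -> M (x * y))].

Lemma frob_step_in M P m r : is_subring P -> M m -> P r ->
  frob_step M P (m * r ^+ p).
Proof.
move=> subP Mm Pr; exists [:: (m, r)], 0; split; last by rewrite big_seq1 mulr0 addr0.
  by move=> x; rewrite inE => /eqP->.
exact: subring0 subP.
Qed.

Lemma frob_step_gen M P m : is_subring P -> M m -> frob_step M P m.
Proof.
move=> subP Mm; have [P1 _ _] := subP.
by have := frob_step_in subP Mm P1; rewrite expr1n mulr1.
Qed.

Lemma frob_step_sub M P z : is_subring P -> (forall m, M m -> P m) ->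
  frob_step M P z -> P z.
Proof.
move=> subP MP [s [r [Ms Pr ->]]]; apply: (subringD subP); last first.
  by apply: (subringM subP) => //; apply: subring_nat.
apply: subring_sum_seq => // x /Ms[Mx Px].
by apply: (subringM subP); [apply: MP|apply: subringX].
Qed.

(** For products, with [y = S' + p q], one has [(S + p r) y = S S' + p (r y + S q)]. Both [S] and
    [y] lie in [P] because [M] does, and [S S'] expands over pairs of terms. *)
Lemma frob_step_subring M P : is_subring P -> is_signed_monoid M ->
  (forall m, M m -> P m) -> is_subring (frob_step M P).
Proof.
move=> subP [M1 MN MM] MP; split; first exact: frob_step_gen.
  move=> _ _ [s [r [Ms Pr ->]]] [t [q [Mt Pq ->]]].
  exists (s ++ [seq (- x.1, x.2) | x <- t]), (r - q); split.
  - move=> x; rewrite mem_cat => /orP[/Ms//|/mapP[y /Mt[My Py] ->]].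
    by split=> //=; apply: MN.
  - by case: subP => _ PB _; apply: PB.
  rewrite big_cat big_map /=.
  under [X in _ = _ + X + _]eq_bigr do rewrite mulNr.
  by rewrite sumrN mulrBr; ring.
move=> x y Sx Sy.
have Py := frob_step_sub subP MP Sy.
case: Sx Sy => [s [r [Ms Pr ->]]] [t [q [Mt Pq Ey]]].
have Ps : P (\sum_(x <- s) x.1 * x.2 ^+ p).
  apply: subring_sum_seq => // z /Ms[Mz Pz].
  by apply: (subringM subP); [apply: MP|apply: subringX].
set S := \sum_(x <- s) _ in Ps *.
exists [seq (x.1 * y.1, x.2 * y.2) | x <- s, y <- t], (r * y + S * q); split.
- move=> _ /allpairsP[[z w] /= [/Ms[Mz Pz] /Mt[Mw Pw] ->]].
  by split; [apply: MM|apply: subringM].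
- by apply: (subringD subP); apply: (subringM subP).
rewrite big_allpairs_dep /=.
have -> : \sum_(x <- s) \sum_(y <- t) x.1 * y.1 * (x.2 * y.2) ^+ p
   = S * \sum_(y <- t) y.1 * y.2 ^+ p.
  rewrite /S mulr_suml; apply: eq_bigr => z _; rewrite mulr_sumr.
  by apply: eq_bigr => w _; rewrite exprMn; ring.
by rewrite Ey; ring.
Qed.

Definition tower M P (n : nat) : R -> Prop := iter n (frob_step M) P.

Section TowerProps.
Variables (M T : R -> Prop).
Hypotheses (subT : is_subring T) (monM : is_signed_monoid M).
Hypothesis MT : forall m, M m -> T m.

Lemma tower_subring_gen n :
  is_subring (tower M T n) /\ (forall m, M m -> tower M T n m).
Proof.
elim: n => [|n [IH1 IH2]] //=; split; first exact: frob_step_subring.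
by move=> m; apply: frob_step_gen.
Qed.

Lemma tower_subring n : is_subring (tower M T n).
Proof. by case: (tower_subring_gen n). Qed.

Lemma tower_gen n m : M m -> tower M T n m.
Proof. by case: (tower_subring_gen n) => _; apply. Qed.

Lemma towerS_sub n z : tower M T n.+1 z -> tower M T n z.
Proof. by apply: frob_step_sub; [apply: tower_subring | apply: tower_gen]. Qed.

Lemma tower_le m n z : (m <= n)%N -> tower M T n z -> tower M T m z.
Proof.
move=> /subnK <-; elim: (n - m)%N => // k IH; rewrite addSn => /towerS_sub.
exact: IH.
Qed.

Lemma tower_exp n z : tower M T n z -> tower M T n.+1 (z ^+ p).
Proof.
move=> Tz; rewrite -[_ ^+ p]mul1r; apply: frob_step_in => //.
  exact: tower_subring.
by case: monM.
Qed.

Variables (k : fieldType) (rho : {rmorphism R -> k}).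
Hypothesis rho_p : rho p%:R = 0.

(** The middle clause is linear independence of the residues over [k^p], with coefficients given by
    their [p]-th roots. Asking for [c v] and [d] in [M] keeps the decomposition inside every subring
    containing [M]. *)
Definition frob_decomposable : Prop :=
  forall s : seq R, (forall m, m \in s -> M m) ->
  exists (V : finType) (E : V -> R),
    [/\ forall v, M (E v),
        forall c : V -> k, \sum_v c v ^+ p * rho (E v) = 0 -> forall v, c v = 0 &
        forall m, m \in s -> exists (c : V -> R) (d : R),
          [/\ forall v, M (c v), M d & m = \sum_v E v * c v ^+ p + p%:R * d]].

Hypothesis decM : frob_decomposable.

(** Modulo [p P], the element becomes [\sum_v E v * w v ^+ p] with [w v] in [P]. A zero residue
    forces every [rho (w v)] to vanish by independence, and then each [w v ^+ p] lies in [p P]. *)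
Lemma frob_step_ker P z : is_subring P -> (forall m, M m -> P m) ->
  (forall x, P x -> rho x = 0 -> mult_of P p (x ^+ p)) ->
  frob_step M P z -> rho z = 0 -> mult_of P p z.
Proof.
move=> subP MP kerP [s [r [Ms Pr ->]]] rho0.
have [m /mapP[x /Ms[Mx _] ->] //|V [E [ME indE decE]]] := decM (s := map fst s).
have [w [Pw [t Pt Et]]] : exists w : V -> R, (forall v, P (w v)) /\
    mult_of P p (\sum_(x <- s) x.1 * x.2 ^+ p - \sum_v E v * w v ^+ p).
  have {r Pr rho0}: forall x, x \in s -> P x.2 /\ x.1 \in map fst s.
    by move=> x xs; split; [case: (Ms x xs)|apply: map_f].
  (* Only the summed list shrinks; [map fst s] stays whole, since [E] was chosen for it. *)
  elim: {1 3}s => [|[m r] u IH] us.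
    exists (fun=> 0); split=> [v|]; first exact: subring0.
    rewrite big_nil big1 ?subr0; first exact: mult_of0.
    by move=> v _; rewrite expr0n (gtn_eqF (prime_gt0 pr_p)) mulr0.
  have [w [Pw Hw]] := IH (fun x xu => us x (mem_behead (s := _ :: _) xu)).
  have [/= Pr /decE[c [d [Mc Md ->]]]] := us _ (mem_head _ _).
  (* As [p]-th powers are additive modulo [p], the new term [m * r ^+ p] is absorbed by adding
     [c v * r] to the root at each [v]. *)
  exists (fun v => c v * r + w v); split.
    by move=> v; apply: (subringD subP) => //; apply: (subringM subP) => //; apply: MP.
  rewrite big_cons /= mulrDl mulr_suml.
  set S1 := \sum_v _; set S2 := \sum_(x <- u) _ in Hw *; set S3 := \sum_v _.
  set S4 := \sum_v _ in Hw.
  have -> : S1 + p%:R * d * r ^+ p + S2 - S3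
    = (S2 - S4) + p%:R * (d * r ^+ p) + (S1 + S4 - S3) by ring.
  apply: mult_ofD => //; first apply: mult_ofD => //.
    by eexists; last reflexivity; apply: (subringM subP); [apply: MP|apply: subringX].
  rewrite /S1 /S4 /S3 -big_split -sumrB /=; apply: mult_of_sum => // v _.
  have -> : E v * c v ^+ p * r ^+ p + E v * w v ^+ p - E v * (c v * r + w v) ^+ p
    = E v * ((c v * r) ^+ p + w v ^+ p - (c v * r + w v) ^+ p).
    by rewrite exprMn; ring.
  apply: mult_ofM => //; first exact: MP.
  by apply: prime_expD_mult_of => //; apply: (subringM subP) => //; apply: MP.
move/eqP: Et; rewrite subr_eq => /eqP Et.
rewrite Et in rho0 *; do ?apply: mult_ofD => //.
- by exists t.
- apply: mult_of_sum => // v _; apply: mult_ofM; [by []|exact: MP|].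
  apply: kerP => //; apply: (indE (fun v => rho (w v))).
  move: rho0; rewrite !rmorphD !rmorphM !rho_p !mul0r addr0 add0r rmorph_sum => rho0.
  rewrite -[RHS]rho0.
  by apply: eq_bigr => v' _; rewrite rmorphM rmorphXn mulrC.
by exists r.
Qed.

(** To iterate [frob_step_ker], its hypothesis must pass up the tower: an [x] at level [n + 1] with
    residue zero is [p r] with [r] at level [n], so [x ^+ p] is [p] times [p ^ (p - 1) * r ^+ p],
    and [r ^+ p] is at level [n + 1]. *)
Lemma tower_ker n z :
  (forall x, T x -> rho x = 0 -> mult_of T p (x ^+ p)) ->
  tower M T n.+1 z -> rho z = 0 -> mult_of (tower M T n) p z.
Proof.
move=> kerT; elim: n z => [|n IH] z; apply: frob_step_ker => //.
- exact: (tower_subring n.+1).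
- exact: (@tower_gen n.+1).
move=> x Tx /(IH _ Tx)[r Tr ->]; rewrite exprMn -(prednK (prime_gt0 pr_p)) exprS.
rewrite (prednK (prime_gt0 pr_p)) -mulrA; eexists; last reflexivity.
apply: (subringM (tower_subring n.+1)); last exact: tower_exp.
by apply: (subringX (tower_subring n.+1)); apply: (subring_nat (tower_subring n.+1)).
Qed.

Hypothesis span_k : forall x : k, exists s : seq (R * k),
  (forall y, y \in s -> M y.1) /\ x = \sum_(y <- s) rho y.1 * y.2 ^+ p.

(** Expand the residue of [x] as a combination of [p]-th powers and lift the roots to level [n]. The
    error is [p r], and [r] lifts to level [n] as well. *)
Lemma tower_surj (S : comPzRingType) (f : {rmorphism R -> S}) (res : S -> k) n :
  (forall z, rho z = res (f z)) -> (forall a, exists x, res x = a) ->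
  (forall x y, res x = res y -> exists r, x = y + p%:R * r) ->
  (forall x, exists2 z, T z & f z = x) ->
  forall x, exists2 z, tower M T n z & f z = x.
Proof.
move=> rhoE surjres kerres surjT; elim: n => [|n IH] x; first exact: surjT.
have [s [Ms Es]] := span_k (res x).
have [t [Mt Et]] : exists t : seq (R * R),
    (forall y, y \in t -> M y.1 /\ tower M T n y.2) /\
    rho (\sum_(y <- t) y.1 * y.2 ^+ p) = \sum_(y <- s) rho y.1 * y.2 ^+ p.
  elim: s Ms {Es} => [|[m a] s IHs] Ms.
    by exists [::]; split=> //; rewrite !big_nil rmorph0.
  have [t [Mt Et]] := IHs (fun x xu => Ms x (mem_behead (s := _ :: _) xu)).
  have [c Ec] := surjres a.
  have [z Tz fz] := IH c.
  exists ((m, z) :: t); split.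
    move=> y; rewrite inE => /orP[/eqP->|/Mt//]; split=> //.
    by apply: (Ms (m, a)); rewrite mem_head.
  by rewrite !big_cons rmorphD Et rmorphM rmorphXn (rhoE z) fz Ec.
set z := \sum_(y <- t) _ in Et.
have /kerres[r Er] : res x = res (f z) by rewrite Es -Et rhoE.
have [w Tw fw] := IH r.
exists (z + p%:R * w); last by rewrite rmorphD rmorphM rmorph_nat fw.
by exists t, w.
Qed.

End TowerProps.
End Tower.

(** * Subfields given by predicates *)

Lemma subfield_subring (K : fieldType) (F : K -> Prop) :
  is_subfield F -> is_subring F.
Proof.
move=> [F0 [F1 FF]]; split=> // x y Fx Fy; last by case: (FF x y Fx Fy).
have [_ FN _ _] := FF y y Fy Fy.
by have [] := FF _ _ Fx FN.
Qed.

Lemma subfieldV (K : fieldType) (F : K -> Prop) x :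
  is_subfield F -> F x -> F x^-1.
Proof. by move=> [_ [_ FF]] Fx; case: (FF x x Fx Fx). Qed.

(* [x^-1 = x^(p-1) * (x^-1)^p] *)
Lemma subring_pth_powers_subfield p (K : fieldType) (S : K -> Prop) :
  (0 < p)%N -> is_subring S -> (forall y, S (y ^+ p)) -> is_subfield S.
Proof.
move=> p_gt0 subS Sp; split; first exact: subring0 subS.
split; first by case: subS.
move=> x y Sx Sy; split.
- exact: (subringD subS).
- exact: (subringN subS).
- exact: (subringM subS).
have [->|x0] := eqVneq x 0; first by rewrite invr0; apply: (subring0 subS).
have -> : x^-1 = x ^+ p.-1 * x^-1 ^+ p.
  by rewrite -[X in _ ^-1 ^+ X](prednK p_gt0) exprS mulrCA -exprMn divff // expr1n mulr1.
by apply: (subringM subS) => //; apply: (subringX subS).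
Qed.

Lemma gen_subfield_subfield (K : fieldType) (G : K -> Prop) :
  is_subfield (gen_subfield G).
Proof.
split; first by move=> S [].
split; first by move=> S [? []].
move=> x y Gx Gy; split=> S subS GS; have Sx := Gx S subS GS;
  have Sy := Gy S subS GS; case: subS => _ [_ SS]; by case: (SS x y Sx Sy).
Qed.

Lemma gen_subfield_gen (K : fieldType) (G : K -> Prop) x : G x -> gen_subfield G x.
Proof. by move=> Gx S _; apply. Qed.

Lemma pth_powers_subfield p (K : fieldType) : prime p -> p%:R = 0 :> K ->
  is_subfield (pth_powers p (K := K)).
Proof.
move=> pr_p p0.
have chK : p \in [pchar K] by rewrite inE pr_p p0 /=.
apply: (subring_pth_powers_subfield (prime_gt0 pr_p)); last by move=> y; exists y.
split; first by exists 1; rewrite expr1n.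
  move=> _ _ [x ->] [y ->]; exists (x - y).
  by rewrite -!(pFrobenius_autE chK) pFrobenius_autB_comm //; apply: mulrC.
by move=> _ _ [x ->] [y ->]; exists (x * y); rewrite exprMn.
Qed.

(** * Linear algebra over a subfield *)

Section LinearAlgebra.
Variables (K : fieldType) (F : K -> Prop).
Hypothesis subF : is_subfield F.
Let ringF := subfield_subring subF.

(** Gaussian elimination with all coefficients kept in [F]: a zero first column is dropped,
    otherwise a pivot row clears it from the other rows. *)
Lemma exists_dependency n m (M : 'I_m -> 'I_n -> K) : (n < m)%N ->
  (forall i j, F (M i j)) ->
  exists c : 'I_m -> K, [/\ forall i, F (c i), exists i, c i != 0 &
    forall j, \sum_i c i * M i j = 0].
Proof.
elim: n m M => [|n IH] [|m] // M lt_nm FM.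
  exists (fun=> 1); split=> [_||[]//]; first by case: ringF.
  by exists ord0; apply: oner_neq0.
have [M0|/existsNP[i0 /eqP Mi0]] := EM (forall i, M i ord0 = 0).
  have [c [Fc nzc cM]] := IH m.+1 (fun i j => M i (lift ord0 j))
    (ltnW lt_nm) (fun i j => FM i (lift ord0 j)).
  exists c; split=> // j; have [j' ->|->] := unliftP ord0 j; first exact: cM.
  by rewrite big1 // => i _; rewrite M0 mulr0.
pose t i := M (lift i0 i) ord0 / M i0 ord0.
have Ft i : F (t i) by apply: (subringM ringF) => //; apply: subfieldV.
have [|c [Fc [i1 nzc] cM]] := IH m
  (fun i j => M (lift i0 i) (lift ord0 j) - t i * M i0 (lift ord0 j)) lt_nm.
  by move=> i j; case: (ringF) => _ FB _; apply: FB => //; apply: (subringM ringF).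
(* The pivot row collects the multiples [t i] that were subtracted from the other rows. *)
pose c' i := if unlift i0 i is Some i' then c i' else - \sum_i c i * t i.
have c'0 : c' i0 = - \sum_i c i * t i by rewrite /c' unlift_none.
have c'l i : c' (lift i0 i) = c i by rewrite /c' liftK.
exists c'; split.
- move=> i; have [i' ->|->] := unliftP i0 i; first by rewrite c'l.
  rewrite c'0; apply: (subringN ringF); apply: (subring_sum ringF) => j _.
  exact: (subringM ringF).
- by exists (lift i0 i1); rewrite c'l.
have sumE j : \sum_i c' i * M i j = \sum_i c i * (M (lift i0 i) j - t i * M i0 j).
  rewrite (bigD1_ord i0) //= c'0 mulNr mulr_suml addrC -sumrB.
  by apply: eq_bigr => i _; rewrite c'l mulrBr (mulrA (c i) (t i)).
move=> j; rewrite sumE; have [j' ->|->] := unliftP ord0 j; first exact: cM.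
by rewrite big1 // => i _; rewrite /t divfK // subrr mulr0.
Qed.

(** A relation among the [w j] expresses one of them through the others. Then the [n] vectors [v i]
    lie in the span of [n - 1] vectors, contradicting their independence. *)
Lemma lin_indep_of_spanning n (v w : 'I_n -> K) : lin_indep_over F v ->
  (forall i, exists c : 'I_n -> K, (forall j, F (c j)) /\ v i = \sum_j c j * w j) ->
  lin_indep_over F w.
Proof.
case: n v w => [|n] v w indv spanw c Fc cw0; first by case.
move=> i0; apply: contrapT => /eqP nz_c.
have {spanw}[M HM] := choice spanw.
have Ew : w i0 = - \sum_(j < n) c (lift i0 j) / c i0 * w (lift i0 j).
  apply: (mulfI nz_c); rewrite mulrN mulr_sumr; apply/eqP; rewrite -addr_eq0.
  rewrite -[X in _ == X]cw0 (bigD1_ord i0) //=; apply/eqP; congr (_ + _).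
  by apply: eq_bigr => j _; rewrite mulrA [_ / _]mulrC mulVKf.
have [|d [Fd [i1 nzd] dM]] := @exists_dependency n n.+1
   (fun i j => M i (lift i0 j) - M i i0 * (c (lift i0 j) / c i0)) (ltnSn n).
  move=> i j; case: (ringF) => _ FB _; apply: FB; first by case: (HM i).
  apply: (subringM ringF); first by case: (HM i).
  by apply: (subringM ringF) => //; apply: subfieldV.
case/eqP: nzd; apply: (indv d Fd).
have vE i : v i = \sum_j (M i (lift i0 j) - M i i0 * (c (lift i0 j) / c i0)) * w (lift i0 j).
  have [_ ->] := HM i; rewrite (bigD1_ord i0) //= Ew mulrN mulr_sumr addrC -sumrB.
  by apply: eq_bigr => j _; rewrite mulrBl !mulrA.
under eq_bigr => i _ do rewrite vE mulr_sumr.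
rewrite exchange_big big1 //= => j _.
under eq_bigr => i _ do rewrite mulrA.
by rewrite -mulr_suml dM mul0r.
Qed.

Lemma lin_indep_of_spanning_fin n (W : finType) (v : 'I_n -> K) (w : W -> K) :
  #|W| = n -> lin_indep_over F v ->
  (forall i, exists c : W -> K, (forall j, F (c j)) /\ v i = \sum_j c j * w j) ->
  forall c : W -> K, (forall j, F (c j)) -> \sum_j c j * w j = 0 ->
  forall j, c j = 0.
Proof.
move=> En; case: n / En v => v indv spanw c Fc cw0 j.
have sumE (d : W -> K) : \sum_j d j * w j = \sum_(i < #|W|) d (enum_val i) * w (enum_val i).
  by rewrite (reindex (@enum_val W predT)) //; apply: onW_bij; apply: enum_val_bij.
rewrite -(enum_rankK j).
have indw : lin_indep_over F (fun i : 'I_#|W| => w (enum_val i)).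
  apply: lin_indep_of_spanning indv _ => i; have [d [Fd ->]] := spanw i.
  by exists (fun i : 'I_#|W| => d (enum_val i)); split.
by apply: (indw (fun i : 'I_#|W| => c (enum_val i))) => //; rewrite -sumE.
Qed.

(** Greedy choice: an element is kept only if it is outside the span of those already kept. *)
Lemma exists_indep_spanning (s : seq K) : exists m (e : 'I_m -> K),
  lin_indep_over F e /\ forall x, x \in s ->
  exists c : 'I_m -> K, (forall i, F (c i)) /\ x = \sum_i c i * e i.
Proof.
elim: s => [|x s [m [e [inde spane]]]].
  by exists 0%N, (fun=> 0); split=> // c _ _ [].
have [xe|xNe] := EM (exists c : 'I_m -> K, (forall i, F (c i)) /\ x = \sum_i c i * e i).
  by exists m, e; split=> // y; rewrite inE => /orP[/eqP->|/spane].
pose e' i := if unlift ord0 i is Some i' then e i' else x.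
have e'0 : e' ord0 = x by rewrite /e' unlift_none.
have e'l i : e' (lift ord0 i) = e i by rewrite /e' liftK.
have sumE (c : 'I_m.+1 -> K) :
    \sum_i c i * e' i = c ord0 * x + \sum_i c (lift ord0 i) * e i.
  by rewrite big_ord_recl e'0; congr (_ + _); apply: eq_bigr => i _; rewrite e'l.
exists m.+1, e'; split; last first.
  move=> y; rewrite inE => /orP[/eqP->|/spane[c [Fc ->]]].
    exists (fun i => (i == ord0)%:R); split; first by move=> i; apply: subring_nat.
    by rewrite sumE eqxx mul1r big1 ?addr0 // => i _; rewrite mul0r.
  exists (fun i => if unlift ord0 i is Some i' then c i' else 0); split.
    by move=> i; case: unlift => // *; apply: subring0.
  rewrite sumE unlift_none mul0r add0r.
  by apply: eq_bigr => i _; rewrite liftK.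
move=> c Fc; rewrite sumE => c0.
have [c00|c00] := eqVneq (c ord0) 0.
  move: c0; rewrite c00 mul0r add0r => /(inde _ (fun i => Fc _)) c0 i.
  by have [i' ->|->] := unliftP ord0 i; rewrite ?c0.
case: xNe; exists (fun i => - (c (lift ord0 i) / c ord0)); split.
  move=> i; apply: (subringN ringF); apply: (subringM ringF) => //.
  exact: subfieldV.
apply: (mulfI c00); apply/eqP; rewrite -subr_eq0 mulr_sumr -sumrN -[X in _ == X]c0.
apply/eqP; congr (_ + _); apply: eq_bigr => i _.
by rewrite mulNr mulrN opprK mulrA [_ / _]mulrC mulVKf.
Qed.

End LinearAlgebra.

(** * Monomials in a [p]-basis *)

Lemma prod_exp_divmod p (R : comPzRingType) r (x : 'I_r -> R) (e : 'I_r -> nat) :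
  \prod_q x q ^+ e q
  = \prod_q x q ^+ (e q %% p) * (\prod_q x q ^+ (e q %/ p)) ^+ p.
Proof.
rewrite -prodrXl -big_split /=; apply: eq_bigr => q _.
by rewrite -exprM -exprD addnC -divn_eq.
Qed.

Section PBasis.
Variables (p : nat) (k1 k2 : fieldType) (ik : k1 -> k2) (beta : k2 -> Prop).
Hypotheses (pr_p : prime p) (beta_pb : is_p_basis p ik beta).
Let p_gt0 := prime_gt0 pr_p.

Definition modn_ffun r (e : 'I_r -> nat) : {ffun 'I_r -> 'I_p} :=
  [ffun q => Ordinal (ltn_pmod (e q) p_gt0)].

(** The [p ^ r] reduced monomials span the field generated by the [b q] over [pK1 p ik]. Its degree
    is [p ^ r], so a spanning family of that size is independent. *)
Lemma p_basis_monomials_indep r (b : 'I_r -> k2) :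
  injective b -> (forall q, beta (b q)) ->
  forall c : {ffun 'I_r -> 'I_p} -> k2, (forall I, pK1 p ik (c I)) ->
  \sum_I c I * \prod_q b q ^+ I q = 0 -> forall I, c I = 0.
Proof.
move=> inj_b beta_b; have [_ /(_ r b inj_b beta_b)[v [adj_v ind_v _]]] := beta_pb.
have subF : is_subfield (pK1 p ik) by apply: gen_subfield_subfield.
have ringF := subfield_subring subF.
have Fp y : pK1 p ik (y ^+ p) by apply: gen_subfield_gen; left; exists y.
apply: (lin_indep_of_spanning_fin subF _ ind_v); first by rewrite card_ffun !card_ord.
pose Sp x := exists c : {ffun 'I_r -> 'I_p} -> k2,
  (forall I, pK1 p ik (c I)) /\ x = \sum_I c I * \prod_q b q ^+ I q.
have SpD x y : Sp x -> Sp y -> Sp (x + y).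
  move=> [c [Fc ->]] [d [Fd ->]]; exists (fun I => c I + d I); split.
    by move=> I; apply: (subringD ringF).
  by rewrite -big_split; apply: eq_bigr => I _; rewrite mulrDl.
have SpZ a x : pK1 p ik a -> Sp x -> Sp (a * x).
  move=> Fa [c [Fc ->]]; exists (fun I => a * c I); split.
    by move=> I; apply: (subringM ringF).
  by rewrite mulr_sumr; apply: eq_bigr => I _; rewrite mulrA.
have Sp_mon (e : 'I_r -> nat) : Sp (\prod_q b q ^+ e q).
  rewrite (prod_exp_divmod p) mulrC; apply: SpZ => //.
  exists (fun I => (I == modn_ffun e)%:R); split.
    by move=> I; apply: (subring_nat ringF).
  rewrite (bigD1 (modn_ffun e)) //= eqxx mul1r [X in _ + X]big1 ?addr0.
    by apply: eq_bigr => q _; rewrite ffunE.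
  by move=> I /negPf->; rewrite mul0r.
have SpF a : pK1 p ik a -> Sp a.
  move=> Fa; rewrite -[a]mulr1; apply: SpZ => //.
  by have := Sp_mon (fun=> 0%N); rewrite big1 //.
have Sp0 : Sp 0 by apply: SpF; apply: (subring0 ringF).
have subSp : is_subring Sp.
  split; first by apply: SpF; case: ringF.
    move=> x y Sx Sy; apply: SpD => //; rewrite -mulN1r; apply: SpZ => //.
    by apply: (subringN ringF); case: ringF.
  move=> _ _ [c [Fc ->]] [d [Fd ->]]; rewrite mulr_suml.
  apply: big_ind => // I _; rewrite mulr_sumr; apply: big_ind => // J _.
  rewrite mulrACA; apply: SpZ; first exact: (subringM ringF).
  rewrite -big_split /=; under eq_bigr => q _ do rewrite -exprD.
  exact: (Sp_mon (fun q => (I q + J q)%N)).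
(* A generated subfield lies in every subfield containing the generators; the span [Sp] is one,
   being a ring that contains all [p]-th powers. *)
move=> i; apply: (adj_v i Sp).
  exact: (subring_pth_powers_subfield p_gt0 subSp (fun y => SpF _ (Fp y))).
move=> y [Fy|[q ->]]; first by apply: SpF; apply: gen_subfield_gen.
have := Sp_mon (fun q' => (q' == q) : nat); rewrite (bigD1 q) //= eqxx expr1.
by rewrite big1 ?mulr1 // => q' /negPf->.
Qed.

Variables (A1 C : comPzRingType) (res1 : {rmorphism A1 -> k1}).
Variables (base : {rmorphism A1 -> C}) (rep : k2 -> C) (rho : {rmorphism C -> k2}).
Hypothesis rho_base : forall a, rho (base a) = ik (res1 a).
Hypothesis rho_rep : forall b, beta b -> rho (rep b) = b.
Hypothesis surj_res1 : forall x, exists a, res1 a = x.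

(** Words with repetition make multiplication a concatenation without fixing a finite part of
    [beta]; signs come from [A1]. *)
Definition gen_monoid (z : C) : Prop :=
  exists a w, (forall b, b \in w -> beta b) /\ z = base a * \prod_(b <- w) rep b.

Lemma gen_monoid_base a : gen_monoid (base a).
Proof. by exists a, [::]; rewrite big_nil mulr1. Qed.

Lemma gen_monoid_rep b : beta b -> gen_monoid (rep b).
Proof.
move=> bb; exists 1, [:: b]; rewrite big_seq1 rmorph1 mul1r; split=> // b'.
by rewrite inE => /eqP->.
Qed.

Lemma gen_monoid_signed : is_signed_monoid gen_monoid.
Proof.
split; first by rewrite -(rmorph1 base); apply: gen_monoid_base.
  by move=> _ [a [w [bw ->]]]; exists (- a), w; rewrite rmorphN mulNr.
move=> _ _ [a [w [bw ->]]] [a' [w' [bw' ->]]]; exists (a * a'), (w ++ w'); split.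
  by move=> b; rewrite mem_cat => /orP[/bw|/bw'].
by rewrite big_cat rmorphM mulrACA.
Qed.

Lemma gen_monoid_monomial r (b : 'I_r -> k2) (e : 'I_r -> nat) :
  (forall q, beta (b q)) -> gen_monoid (\prod_q rep (b q) ^+ e q).
Proof.
move=> beta_b; have [M1 _ MM] := gen_monoid_signed.
apply: big_ind => // q _; elim: (e q) => [|n IH] //.
by rewrite exprS; apply: MM => //; apply: gen_monoid_rep.
Qed.

(** The sums on the right form a ring containing all [p]-th powers, hence a field; it contains [k1]
    and [beta], which together with the [p]-th powers generate [k2]. *)
Lemma gen_monoid_span (x : k2) : exists s : seq (C * k2),
  (forall y, y \in s -> gen_monoid y.1) /\ x = \sum_(y <- s) rho y.1 * y.2 ^+ p.
Proof.
have [M1 MN MM] := gen_monoid_signed.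
have gen1 m y : gen_monoid m -> exists s : seq (C * k2),
    (forall z, z \in s -> gen_monoid z.1) /\ 
    rho m * y ^+ p = \sum_(z <- s) rho z.1 * z.2 ^+ p.
  move=> Mm; exists [:: (m, y)]; rewrite big_seq1; split=> // z.
  by rewrite inE => /eqP->.
have genp y := gen1 1 y M1; have gen m Mm := gen1 m 1 Mm.
rewrite rmorph1 in genp.
have [adj _] := beta_pb; apply: (adj x (fun x => exists s : seq (C * k2),
  (forall y, y \in s -> gen_monoid y.1) /\ x = \sum_(y <- s) rho y.1 * y.2 ^+ p)).
  apply: (subring_pth_powers_subfield p_gt0); last first.
    by move=> y; rewrite -[y ^+ p]mul1r; apply: genp.
  split.
  - by have := genp 1; rewrite mul1r expr1n.
  - move=> _ _ [s [Ms ->]] [t [Mt ->]].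
    exists (s ++ [seq (- y.1, y.2) | y <- t]); split.
      move=> y; rewrite mem_cat => /orP[/Ms//|/mapP[z /Mt Mz ->]]; exact: MN.
    rewrite big_cat big_map -sumrN; congr (_ + _); apply: eq_bigr => y _.
    by rewrite rmorphN mulNr.
  move=> _ _ [s [Ms ->]] [t [Mt ->]].
  exists [seq (x.1 * y.1, x.2 * y.2) | x <- s, y <- t]; split.
    by move=> _ /allpairsP[[z w] /= [/Ms Mz /Mt Mw ->]]; apply: MM.
  rewrite big_allpairs_dep /= mulr_suml; apply: eq_bigr => z _; rewrite mulr_sumr.
  by apply: eq_bigr => w _; rewrite rmorphM exprMn mulrACA.
move=> y [[[z ->]|[z ->]]|by_]; first by rewrite -[_ ^+ _]mul1r.
  have [a <-] := surj_res1 z; rewrite -rho_base -[rho _]mulr1 -(expr1n _ p).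
  by apply: gen; apply: gen_monoid_base.
rewrite -(rho_rep by_) -[rho _]mulr1 -(expr1n _ p).
by apply: gen; apply: gen_monoid_rep.
Qed.

Lemma prod_word_count r (b : 'I_r -> k2) (w : seq k2) : injective b ->
  (forall x, x \in w -> exists q, x = b q) ->
  \prod_(x <- w) rep x = \prod_q rep (b q) ^+ count_mem (b q) w.
Proof.
move=> inj_b; elim: w => [|x w IH] wb; first by rewrite big_nil big1.
have [q Eq] := wb x (mem_head _ _).
rewrite big_cons IH; last by move=> y yw; apply: wb; rewrite inE yw orbT.
rewrite (bigD1 q) //= [RHS](bigD1 q) //= Eq eqxx exprS mulrA.
congr (_ * _); apply: eq_bigr => q' nq.
by rewrite (inj_eq inj_b) eq_sym (negPf nq).
Qed.

Hypothesis ker_res1 : forall a, res1 a = 0 -> exists a', a = p%:R * a'.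
Hypothesis p0 : p%:R = 0 :> k1.
Hypothesis sep_k : separable_ext p ik.

(** The [E v] are lifts of products [e i * b^I], with [e] independent over [k1^p] and spanning the
    coefficients, and [b^I] a reduced monomial in the occurring elements of [beta]. Monomials are
    independent over the field generated by [k2^p] and [k1], and separability keeps [e] independent
    over [k2^p]. *)
Lemma gen_monoid_decomposable : frob_decomposable p gen_monoid rho.
Proof.
move=> s Ms; have [M1 MN MM] := gen_monoid_signed.
have [t [bt ->]] : exists t : seq (A1 * seq k2),
    (forall x, x \in t -> forall b, b \in x.2 -> beta b) /\
    s = [seq base x.1 * \prod_(b <- x.2) rep b | x <- t].
  elim: s Ms => [|m s IH] Ms; first by exists [::].
  have [a [w [bw ->]]] := Ms m (mem_head _ _).
  have [|t [bt ->]] := IH; first by move=> m' ms; apply: Ms; rewrite inE ms orbT.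
  exists ((a, w) :: t); split=> // x; rewrite inE => /orP[/eqP->//|]; exact: bt.
(* Duplicates are removed because [p]-independence concerns pairwise distinct elements. *)
pose L := undup (flatten (map snd t)).
pose b (q : 'I_(size L)) := nth 0 L q.
have inj_b : injective b.
  by move=> q q' /eqP; rewrite nth_uniq ?undup_uniq // => /eqP/val_inj.
have memL x y : x \in t -> y \in x.2 -> exists q, y = b q.
  move=> xt yx; have yL : y \in L.
    by rewrite mem_undup; apply/flattenP; exists x.2 => //; apply: map_f.
  have ltq : (index y L < size L)%N by rewrite index_mem.
  by exists (Ordinal ltq); rewrite /b /= nth_index.
have beta_b q : beta (b q).
  have : b q \in L by apply: mem_nth.
  by rewrite mem_undup => /flattenP[_ /mapP[x xt ->]]; apply: bt.
have subkp := pth_powers_subfield pr_p p0.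
have [m [e [ind_e span_e]]] := exists_indep_spanning subkp (map (res1 \o fst) t).
have [lft lftK] := choice surj_res1.
exists ('I_m * {ffun 'I_(size L) -> 'I_p})%type.
exists (fun v : 'I_m * {ffun 'I_(size L) -> 'I_p} => base (lft (e v.1)) * \prod_q rep (b q) ^+ v.2 q); split.
- move=> v; apply: MM; first exact: gen_monoid_base.
  exact: (gen_monoid_monomial (fun q => v.2 q)).
- move=> c c0.
  (* Grouping by monomial puts the coefficients in the field generated by [k2^p] and [k1]. *)
  have {}c0 : \sum_I (\sum_i c (i, I) ^+ p * ik (e i)) * \prod_q b q ^+ I q = 0.
    rewrite -[RHS]c0; under eq_bigr => I _ do rewrite mulr_suml.
    rewrite exchange_big pair_big /=; apply: eq_bigr => -[i I] _ /=.
    rewrite rmorphM rho_base lftK rmorph_prod -mulrA; congr (_ * (_ * _)).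
    by apply: eq_bigr => q _; rewrite rmorphXn rho_rep.
  have {}c0 := p_basis_monomials_indep inj_b beta_b _ c0.
  have ringF := subfield_subring (gen_subfield_subfield
    (fun x => pth_powers p x \/ exists y, x = ik y)).
  move=> [i I].
  have /(sep_k ind_e) : \sum_i c (i, I) ^+ p * ik (e i) = 0.
    apply: c0 => J; apply: (subring_sum ringF) => j _; apply: (subringM ringF).
      by apply: gen_subfield_gen; left; exists (c (j, J)).
    by apply: gen_subfield_gen; right; exists (e j).
  move=> H; apply/eqP; move: (H (fun j => ex_intro _ (c (j, I)) erefl) i) => /eqP.
  by rewrite expf_eq0 p_gt0.
move=> _ /mapP[[a w] xt ->] /=.
have [g0 [/choice[g Eg] Ea]] := span_e (res1 a) (map_f (res1 \o fst) xt).
have [a' Ea'] : exists a', a - \sum_i lft (e i) * lft (g i) ^+ p = p%:R * a'.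
  apply: ker_res1; rewrite rmorphB rmorph_sum Ea; apply/eqP; rewrite subr_eq0.
  by apply/eqP/eq_bigr => i _; rewrite rmorphM rmorphXn !lftK Eg mulrC.
have Ew := prod_word_count inj_b (memL _ ^~ xt).
pose cnt q := count_mem (b q) w.
(* Only the monomial with exponents [cnt] modulo [p] contributes; the quotients of the exponents go
   into the [p]-th power. The default is [base 0], which is zero and visibly in the monoid. *)
exists (fun v : 'I_m * {ffun 'I_(size L) -> 'I_p} => if v.2 == modn_ffun cnt
  then base (lft (g v.1)) * \prod_q rep (b q) ^+ (cnt q %/ p) else base 0).
exists (base a' * \prod_(y <- w) rep y); split.
- move=> v; case: eqP => _; last exact: gen_monoid_base.
  apply: MM; first exact: gen_monoid_base.
  exact: (gen_monoid_monomial (fun q => (cnt q %/ p)%N)).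
- by exists a', w; split=> //; apply: (bt _ xt).
have -> : a = \sum_i lft (e i) * lft (g i) ^+ p + p%:R * a' by rewrite -Ea' addrC subrK.
rewrite rmorphD rmorphM rmorph_nat mulrDl -mulrA; congr (_ + _).
rewrite -(pair_bigA _ (fun i (I : {ffun 'I_(size L) -> 'I_p}) => base (lft (e i)) * \prod_q rep (b q) ^+ I q *
  (if I == modn_ffun cnt
  then base (lft (g i)) * \prod_q rep (b q) ^+ (cnt q %/ p) else base 0) ^+ p)) /=.
rewrite rmorph_sum mulr_suml; apply: eq_bigr => i _.
rewrite (bigD1 (modn_ffun cnt)) //= eqxx [X in _ + X]big1 ?addr0; last first.
  by move=> I /negPf->; rewrite rmorph0 expr0n gtn_eqF // mulr0.
rewrite Ew (prod_exp_divmod p) rmorphM rmorphXn exprMn.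
rewrite [RHS]mulrACA; congr (_ * (_ * _)).
by apply: eq_bigr => q _; rewrite ffunE.
Qed.

End PBasis.

(** * Divisibility by powers of [p] *)

Section PAdic.
Variables (p : nat) (B : comPzRingType).
Implicit Types (x y : B) (n : nat).

Lemma pdivnD n x y : pdivn p n x -> pdivn p n y -> pdivn p n (x + y).
Proof. by move=> [a ->] [b ->]; exists (a + b); rewrite mulrDr. Qed.

Lemma pdivnN n x : pdivn p n x -> pdivn p n (- x).
Proof. by move=> [a ->]; exists (- a); rewrite mulrN. Qed.

Lemma pdivnMl n x y : pdivn p n y -> pdivn p n (x * y).
Proof. by move=> [a ->]; exists (x * a); rewrite mulrCA. Qed.

Lemma pdivn_sum n (I : eqType) (s : seq I) (F : I -> B) :
  (forall i, i \in s -> pdivn p n (F i)) -> pdivn p n (\sum_(i <- s) F i).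
Proof.
move=> PF; rewrite big_seq; apply: big_ind => //; last exact: pdivnD.
by exists 0; rewrite mulr0.
Qed.

Lemma pdivn_le m n x : (m <= n)%N -> pdivn p n x -> pdivn p m x.
Proof. by move=> /subnKC <- [a ->]; rewrite exprD -mulrA; eexists. Qed.

(** In [x^p - y^p = (x - y) * \sum_i x^(p-1-i) y^i] the second factor is congruent to [p y^(p-1)]
    modulo [x - y], hence divisible by [p]. *)
Lemma pdivn_expB n x y :
  pdivn p n.+1 (x - y) -> pdivn p n.+2 (x ^+ p - y ^+ p).
Proof.
move=> dxy; rewrite subrXX.
have [c ->] : pdivn p 1 (\sum_(i < p) x ^+ (p.-1 - i) * y ^+ i).
  have -> : \sum_(i < p) x ^+ (p.-1 - i) * y ^+ i =
    \sum_(i < p) y ^+ i * (x ^+ (p.-1 - i) - y ^+ (p.-1 - i)) + p%:R * y ^+ p.-1.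
    rewrite mulr_natl -[X in _ *+ X](card_ord p) -sumr_const -big_split /=.
    apply: eq_bigr => -[i /= lt_ip] _.
    have -> : y ^+ p.-1 = y ^+ i * y ^+ (p.-1 - i).
      by rewrite -exprD subnKC // -ltnS (ltn_predK lt_ip).
    ring.
  apply: pdivnD; last by exists (y ^+ p.-1).
  apply: pdivn_sum => i _; apply: pdivnMl; rewrite subrXX mulrC; apply: pdivnMl.
  exact: pdivn_le dxy.
case: dxy => d ->; exists (d * c); by rewrite expr1 (exprSr _ n.+1) mulrACA.
Qed.

(** At the last power of [p] dividing [x], the quotient is outside [p B] and so is a unit. *)
Lemma not_pdivn n x : local_pA p B -> ~ pdivn p n x ->
  exists2 i, (i < n)%N & exists u w, x = p%:R ^+ i * u /\ u * w = 1.
Proof.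
move=> locB; elim: n => [|n IH] ndiv.
  by case: ndiv; exists x; rewrite mul1r.
have [[u Eu]|/IH[i lt_in H]] := EM (pdivn p n x); last by exists i => //; apply: ltnW.
have [|w uw] := locB u; last by exists n => //; exists u, w.
by move=> [b Eb]; apply: ndiv; exists b; rewrite Eu Eb mulrA -exprD addn1.
Qed.

End PAdic.

(** * Existence and uniqueness of the lift *)

Section Lift.
Variables (p : nat) (A B : comPzRingType) (k l : fieldType).
Variables (resA : {rmorphism A -> k}) (resB : {rmorphism B -> l}).
Variable Phik : {rmorphism k -> l}.
Hypotheses (pr_p : prime p) (surjA : forall y, exists a, resA a = y).
Hypothesis kerA : forall a, resA a = 0 <-> in_pA p a.
Hypothesis surjB : forall y, exists b, resB b = y.
Hypothesis kerB : forall b, resB b = 0 <-> in_pA p b.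
Hypothesis locA : local_pA p A.
Hypotheses (sepB : padic_separated p B) (complB : padic_complete p B).
Hypothesis torsion : forall n, p%:R ^+ n = 0 :> A -> p%:R ^+ n = 0 :> B.

Let C : comPzRingType := (A * B)%type.
Let rho : {rmorphism C -> k} := (resA \o fst)%FUN.

Definition residue_compatible (z : C) : Prop := resB z.2 = Phik (resA z.1).
Local Notation T := residue_compatible.

Variable M : C -> Prop.
Hypotheses (monM : is_signed_monoid M) (MT : forall m, M m -> T m).
Hypothesis decM : frob_decomposable p M rho.
Hypothesis spanM : forall x : k, exists s : seq (C * k),
  (forall y, y \in s -> M y.1) /\ x = \sum_(y <- s) rho y.1 * y.2 ^+ p.

Local Notation tw := (tower p M T).

Lemma residue_compatible_subring : is_subring T.
Proof.
split; rewrite /T /=; first by rewrite !rmorph1.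
  by move=> x y; rewrite !rmorphB => -> ->.
by move=> x y; rewrite !rmorphM => -> ->.
Qed.
Let subT := residue_compatible_subring.
Let subtw n : is_subring (tw n) := tower_subring p subT monM MT n.

Let resAp : resA p%:R = 0.
Proof. by apply/kerA; exists 1; rewrite mulr1. Qed.
Let resBp : resB p%:R = 0.
Proof. by apply/kerB; exists 1; rewrite mulr1. Qed.

Let fst_nat n : (n%:R : C).1 = n%:R.
Proof. exact: (rmorph_nat (fst : {rmorphism C -> A})). Qed.
Let snd_nat n : (n%:R : C).2 = n%:R.
Proof. exact: (rmorph_nat (snd : {rmorphism C -> B})). Qed.

(** Here [x = p y] where [y] may fall outside [T]. Since [p >= 2], the quotient of [x ^+ p] by [p]
    still has a factor [p], and all multiples of [p] are in [T]. *)
Lemma residue_compatible_ker x : T x -> rho x = 0 -> mult_of T p (x ^+ p).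
Proof.
case: x => a b; rewrite {1}/T /rho /= => Tab a0.
have [a' Ea] := (kerA a).1 a0.
have [|b' Eb] := (kerB b).1; first by rewrite Tab a0 rmorph0.
have -> : ((a, b) : C) = p%:R * (a', b').
  have En : (p%:R : C) = (p%:R, p%:R) by rewrite [LHS]surjective_pairing fst_nat snd_nat.
  by rewrite Ea Eb En !expr1.
have Tp y : T (p%:R * y).
  by rewrite /T /= fst_nat snd_nat !rmorphM resAp resBp rmorph0 !mul0r.
have [q Eq] : exists q, p = q.+2 by case: p pr_p => [|[|q]] // _; exists q.
rewrite exprMn {3}Eq exprS -mulrA; eexists; last reflexivity.
by rewrite exprS -mulrA.
Qed.

(** By [tower_ker], [z = p r] with [r] one level lower. If [r.1] has the divisibility required
    there, induction concludes; it can fail only when [p] is nilpotent in [A]. *)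
Lemma tower_dvd n z : tw n z -> pdivn p n.+1 z.1 -> pdivn p n.+1 z.2.
Proof.
elim/ltn_ind: n z => -[|n] IH z Tz dz1.
  by apply/kerB; rewrite Tz (kerA z.1).2 // rmorph0.
have rho0 : rho z = 0 by apply/kerA/(pdivn_le _ dz1).
have rhop : rho p%:R = 0 by rewrite /rho /= fst_nat.
have [r Tr Ez] := tower_ker pr_p subT monM MT rhop decM residue_compatible_ker Tz rho0.
have [dr|ndr] := EM (pdivn p n.+1 r.1).
  have [c Ec] := IH n (ltnSn n) r Tr dr.
  by exists c; rewrite Ez /= snd_nat Ec [in RHS]exprS mulrA.
(* Now [r.1 = p^i u] with [u] a unit and [i <= n], while [p^(i+1) u] is divisible by [p^(n+2)]. So
   [p^(i+1) (1 - p c) = 0] with [1 - p c] a unit, and [p^(i+1)] vanishes in [A], hence in [B].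
   Induction at level [i] then gives [z.2 = 0]. *)
have [i lt_in [u [w [Er uw]]]] := not_pdivn locA ndr.
case: (dz1) => b Eb.
pose c := p%:R ^+ (n - i) * b * w.
have Ei : p%:R ^+ i.+1 * (1 - p%:R * c) = 0 :> A.
  have H : p%:R ^+ i.+1 * u = p%:R ^+ n.+2 * b.
    by rewrite -Eb Ez /= fst_nat Er exprS mulrA.
  have En : n.+2 = (i.+1 + (n - i).+1)%N by rewrite addSn addnS subnKC.
  rewrite En exprD (exprS _ (n - i)) in H.
  have E : p%:R ^+ i.+1 = p%:R ^+ i.+1 * u * w :> A by rewrite -mulrA uw mulr1.
  by rewrite mulrBr mulr1 {1}E H /c; ring.
have [|d Ed] := locA (a := 1 - p%:R * c).
  by move/kerA/eqP; rewrite rmorphB rmorph1 rmorphM resAp mul0r subr0 oner_eq0.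
have pA0 : p%:R ^+ i.+1 = 0 :> A by rewrite -[LHS]mulr1 -[X in _ * X = _]Ed mulrA Ei mul0r.
have [|e ->] := IH i lt_in z (tower_le subT monM MT (ltnW lt_in) Tz).
  by apply: pdivn_le dz1; apply: leqW.
by rewrite (torsion pA0) mul0r; exists 0; rewrite mulr0.
Qed.

Lemma tower_onto n x : exists2 z, tw n z & z.1 = x.
Proof.
have [] // := @tower_surj p C M T k rho spanM A fst resA n _ surjA _ _ x.
- by move=> a a' /eqP; rewrite -subr_eq0 -rmorphB => /eqP/kerA[b Eb];
    exists b; rewrite -[p%:R]expr1 -Eb addrC subrK.
- by move=> a; have [b Eb] := surjB (Phik (resA a)); exists (a, b).
by move=> z; exists z.
Qed.

(** The graph of the lift: the intersection of the [p]-adic thickenings of the levels in the [B]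
    direction. *)
Definition lift_rel (x : A) (y : B) : Prop :=
  forall n, exists z, [/\ tw n z, z.1 = x & pdivn p n.+1 (y - z.2)].

(** Two points of a level over the same [x] differ by a point with first component zero, to which
    [tower_dvd] applies. *)
Lemma lift_rel_tower x y n z :
  lift_rel x y -> tw n z -> z.1 = x -> pdivn p n.+1 (y - z.2).
Proof.
move=> /(_ n)[w [Tw Ew dw]] Tz Ez.
have -> : y - z.2 = (y - w.2) + (w - z).2 by rewrite /= addrA subrK.
apply: pdivnD => //; apply: tower_dvd; first by case: (subtw n) => _ + _; apply.
by rewrite /= Ew Ez subrr; exists 0; rewrite mulr0.
Qed.

(** Points over [x] chosen at each level have Cauchy second components, because the levels decrease
    and [tower_dvd] bounds the differences; [y] is the limit. *)
Lemma lift_rel_ex x : exists y, lift_rel x y.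
Proof.
have /choice[r Hr] : forall n, exists z, tw n z /\ z.1 = x.
  by move=> n; have [z Tz Ez] := tower_onto n x; exists z.
have cau n i j : (n <= i)%N -> (n <= j)%N -> pdivn p n.+1 ((r i).2 - (r j).2).
  move=> ni nj; have [[Ti Ei] [Tj Ej]] := (Hr i, Hr j).
  apply: (@tower_dvd n (r i - r j)); last first.
    by rewrite /= Ei Ej subrr; exists 0; rewrite mulr0.
  have [_ TB _] := subtw n.
  by apply: TB; [apply: tower_le ni Ti|apply: tower_le nj Tj].
have [|y Hy] := complB (u := fun n => (r n).2).
  move=> n; exists n => i j ni nj.
  by apply: pdivn_le (cau _ _ _ ni nj).
exists y => n; exists (r n); have [Tn En] := Hr n; split=> //.
have [N HN] := Hy n.+1.
(* The index [maxn n N] is late enough both to be close to the limit and to be compared with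
   [r n]. *)
have -> : y - (r n).2 = - ((r (maxn n N)).2 - y) + ((r (maxn n N)).2 - (r n).2) by ring.
apply: pdivnD; first by apply/pdivnN/HN/leq_maxr.
by apply: cau => //; apply: leq_maxl.
Qed.

Lemma lift_rel_uniq x y y' : lift_rel x y -> lift_rel x y' -> y = y'.
Proof.
move=> Hy Hy'; apply/eqP; rewrite -subr_eq0; apply/eqP; apply: sepB => n.
have [z [Tz Ez dz]] := Hy n.
have -> : y - y' = (y - z.2) - (y' - z.2) by ring.
apply: (pdivn_le (leqnSn n)); apply: pdivnD => //; apply: pdivnN.
exact: lift_rel_tower Hy' Tz Ez.
Qed.

Lemma lift_rel_gen m : M m -> lift_rel m.1 m.2.
Proof.
move=> Mm n; exists m; split=> //; first exact: tower_gen.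
by rewrite subrr; exists 0; rewrite mulr0.
Qed.

Lemma lift_relD x y x' y' :
  lift_rel x y -> lift_rel x' y' -> lift_rel (x + x') (y + y').
Proof.
move=> H H' n; have [z [Tz Ez dz]] := H n; have [z' [Tz' Ez' dz']] := H' n.
exists (z + z'); split; first exact: (subringD (subtw n)).
  by rewrite /= Ez Ez'.
have -> : y + y' - (z + z').2 = (y - z.2) + (y' - z'.2) by rewrite /=; ring.
exact: pdivnD.
Qed.

Lemma lift_relM x y x' y' :
  lift_rel x y -> lift_rel x' y' -> lift_rel (x * x') (y * y').
Proof.
move=> H H' n; have [z [Tz Ez dz]] := H n; have [z' [Tz' Ez' dz']] := H' n.
exists (z * z'); split; first exact: (subringM (subtw n)).
  by rewrite /= Ez Ez'.
have -> : y * y' - (z * z').2 = y' * (y - z.2) + z.2 * (y' - z'.2) by rewrite /=; ring.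
by apply: pdivnD; apply: pdivnMl.
Qed.

Lemma lift_rel_res x y : lift_rel x y -> resB y = Phik (resA x).
Proof.
move=> /(_ 0%N)[z [Tz <- /kerB/eqP]].
by rewrite rmorphB subr_eq0 => /eqP->; apply: Tz.
Qed.

(** Each step gains a power of [p]: [Psi] is exact on the factors from [M], [pdivn_expB] improves
    the [p]-th powers, and the remainder carries a factor [p]. *)
Lemma morphism_tower (Psi : {rmorphism A -> B}) n z :
  (forall x, resB (Psi x) = Phik (resA x)) -> (forall m, M m -> Psi m.1 = m.2) ->
  tw n z -> pdivn p n.+1 (Psi z.1 - z.2).
Proof.
move=> Psires PsiM; elim: n z => [|n IH] z.
  by move=> Tz; apply/kerB; rewrite rmorphB Psires Tz subrr.
move=> [s [r [Ms Tr ->]]].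
rewrite (rmorphD fst) (rmorphD snd) !(rmorph_sum fst) !(rmorph_sum snd) /=.
rewrite rmorphD rmorph_sum /= fst_nat snd_nat rmorphM rmorph_nat.
set S1 := \sum_(i <- s) _; set S2 := \sum_(i <- s) _.
have -> : S1 + p%:R * Psi r.1 - (S2 + p%:R * r.2)
  = (S1 - S2) + p%:R * (Psi r.1 - r.2) by ring.
apply: pdivnD; last by have [c ->] := IH r Tr; exists c; rewrite [in RHS]exprS mulrA.
rewrite -sumrB; apply: pdivn_sum => x /Ms[Mx Tx].
rewrite rmorphM PsiM // (rmorphXn fst) (rmorphXn snd) rmorphXn -mulrBr.
by apply: pdivnMl; apply: pdivn_expB; apply: IH.
Qed.

(** Every identity for [Phi] comes from [lift_rel_uniq], since [lift_rel] is closed under the ring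
    operations. A competitor [Psi] agrees with [Phi] modulo all powers of [p], both being close to
    the same tower points. *)
Lemma exists_unique_lift : exists Phi : A -> B,
  [/\ is_cohen_morphism p resA resB Phi Phik, forall m, M m -> Phi m.1 = m.2 &
      forall Psi : A -> B, is_cohen_morphism p resA resB Psi Phik ->
      (forall m, M m -> Psi m.1 = m.2) -> forall x, Psi x = Phi x].
Proof.
have [Phi HPhi] := choice lift_rel_ex; exists Phi; split.
- split.
  + split; [|split].
    * apply: lift_rel_uniq (HPhi _) _; have [M1 _ _] := monM.
      exact: (lift_rel_gen M1).
    * by move=> x y; apply: lift_rel_uniq (HPhi _) _; apply: lift_relD.
    * by move=> x y; apply: lift_rel_uniq (HPhi _) _; apply: lift_relM.
  + by split; [apply: rmorph1|split; [apply: rmorphD|apply: rmorphM]].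
  + move=> a; rewrite -kerA -kerB (lift_rel_res (HPhi a)).
    by split=> [/eqP|->]; [rewrite fmorph_eq0 => /eqP|rewrite rmorph0].
  + by move=> a; rewrite (lift_rel_res (HPhi a)).
- by move=> m Mm; apply: lift_rel_uniq (HPhi _) _; apply: lift_rel_gen.
move=> Psi [/ring_hom_rmorphism[Psi' ->] _ _ Psires] PsiM x.
apply/eqP; rewrite -subr_eq0; apply/eqP; apply: sepB => n.
have [z [Tz Ez dz]] := HPhi x n.
have -> : Psi' x - Phi x = (Psi' z.1 - z.2) - (Phi x - z.2) by rewrite Ez; ring.
apply: (pdivn_le (leqnSn n)); apply: pdivnD; last exact: pdivnN.
exact: morphism_tower.
Qed.

End Lift.

(** * Application to the given extensions *)

Unset Implicit Arguments.

Theorem theorem7p1 (p : nat) (pr_p : prime p)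
  (A1 A2 B1 B2 : comPzRingType) (k1 k2 l1 l2 : fieldType)
  (resA1 : A1 -> k1) (resA2 : A2 -> k2) (resB1 : B1 -> l1) (resB2 : B2 -> l2)
  (iA : A1 -> A2) (ik : k1 -> k2) (jB : B1 -> B2) (jl : l1 -> l2)
  (extA : is_cohen_ext p resA1 resA2 iA ik)
  (extB : is_cohen_ext p resB1 resB2 jB jl)
  (sep_k : separable_ext p ik)
  (phiA : A1 -> B1) (phik : k1 -> l1)
  (phi_mor : is_cohen_morphism p resA1 resB1 phiA phik)
  (Phik : k2 -> l2) (Phik_hom : ring_hom (Phik : k2 -> l2))
  (Phik_ext : forall x : k1, Phik (ik x) = jl (phik x))
  (sep_l : separable_ext p Phik)
  (beta : k2 -> Prop) (beta_pb : is_p_basis p ik beta)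
  (sA : k2 -> A2) (sA_rep : forall b, beta b -> resA2 (sA b) = b)
  (sB : l2 -> B2) (sB_rep : forall b, beta b -> resB2 (sB (Phik b)) = Phik b) :
  exists PhiA : A2 -> B2,
    (is_cohen_morphism p resA2 resB2 PhiA Phik
     /\ (forall b, beta b -> PhiA (sA b) = sB (Phik b))
     /\ (forall a : A1, PhiA (iA a) = jB (phiA a)))
    /\ forall PsiA : A2 -> B2,
         is_cohen_morphism p resA2 resB2 PsiA Phik ->
         (forall b, beta b -> PsiA (sA b) = sB (Phik b)) ->
         (forall a : A1, PsiA (iA a) = jB (phiA a)) ->
         forall x : A2, PsiA x = PhiA x.
Proof.
have [[hA1 [srA1 krA1 _ _ _]] [hA2 [srA2 krA2 lcA2 _ _]] injA _ [hiA hik _ resiA]] := extA.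
have [_ [hB2 [srB2 krB2 _ _ [sepB cplB]]] _ _ [hjB hjl _ resjB]] := extB.
have [hphiA hphik _ resphi] := phi_mor.
have [rA1 E1] := ring_hom_rmorphism hA1; subst resA1.
have [rA2 E2] := ring_hom_rmorphism hA2; subst resA2.
have [rB2 E3] := ring_hom_rmorphism hB2; subst resB2.
have [jA E4] := ring_hom_rmorphism hiA; subst iA.
have [jB' E5] := ring_hom_rmorphism hjB; subst jB.
have [fA E6] := ring_hom_rmorphism hphiA; subst phiA.
have [F E7] := ring_hom_rmorphism Phik_hom; subst Phik.
pose C : comPzRingType := (A2 * B2)%type.
(* The graph of the lift must contain these pairs and the pairs [rep b] below; they generate [M]. *)
pose base0 a : C := (jA a, jB' (fA a)).
have [|base Ebase] := @ring_hom_rmorphism A1 C base0.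
  split; first by rewrite /base0 !rmorph1.
  by split=> x y; rewrite /base0 ?rmorphD ?rmorphM.
have baseE a : base a = (jA a, jB' (fA a)) by rewrite -Ebase.
pose rep b : C := (sA b, sB (F b)).
pose rho : {rmorphism C -> k2} := (rA2 \o fst)%FUN.
have rho_base a : rho (base a) = ik (rA1 a) by rewrite baseE /= resiA.
have rho_rep b : beta b -> rho (rep b) = b by apply: sA_rep.
pose M := gen_monoid beta base rep.
have subT := residue_compatible_subring rA2 rB2 F.
have baseT a : residue_compatible rA2 rB2 F (base a).
  by rewrite baseE /residue_compatible /= -resiA -resjB -resphi Phik_ext.
have MT m : M m -> residue_compatible rA2 rB2 F m.
  move=> [a [w [bw ->]]]; apply: (subringM subT); first exact: baseT.
  rewrite big_seq; apply: big_ind.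
  - by case: subT.
  - exact: (subringM subT).
  by move=> b /bw bb; rewrite /residue_compatible /= sB_rep // sA_rep.
have p0 : p%:R = 0 :> k1.
  by rewrite -(rmorph_nat rA1); apply/krA1; exists 1; rewrite mulr1.
have ker1 a : rA1 a = 0 -> exists a', a = p%:R * a'.
  by move/krA1 => [a' ->]; exists a'.
have decM : frob_decomposable p M rho.
  exact: (gen_monoid_decomposable pr_p beta_pb rho_base rho_rep srA1 ker1 p0 sep_k).
have spanM := gen_monoid_span pr_p beta_pb rho_base rho_rep srA1.
(* The relation descends to [A1] by injectivity of the inclusion and is carried to [B2] through
   [B1]. *)
have torsion n : p%:R ^+ n = 0 :> A2 -> p%:R ^+ n = 0 :> B2.
  move=> pn0; have : p%:R ^+ n = 0 :> A1.
    by apply: injA; rewrite rmorphXn rmorph_nat rmorph0.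
  by move/(congr1 (jB' \o fA)); rewrite /= !rmorphXn !rmorph_nat !rmorph0.
have [Phi [Phi_mor PhiM Phi_uniq]] := exists_unique_lift pr_p srA2 krA2 srB2 krB2
  lcA2 sepB cplB torsion (gen_monoid_signed _ _ _) MT decM spanM.
exists Phi; split; first split=> //.
  split=> [b bb|a]; first exact: (PhiM (rep b) (gen_monoid_rep _ _ bb)).
  by have := PhiM _ (gen_monoid_base _ _ _ a); rewrite baseE.
(* The prescribed values on the generators extend to all words by multiplicativity of [Psi]. *)
move=> Psi Psi_mor Psi_rep Psi_base; apply: Phi_uniq => // _ [a [w [bw ->]]].
have [hPsi _ _ _] := Psi_mor.
have [Psi' EPsi] := ring_hom_rmorphism hPsi; subst Psi.
rewrite (rmorphM (fst : {rmorphism C -> A2})) (rmorphM (snd : {rmorphism C -> B2})).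
rewrite rmorphM /= baseE /= Psi_base; congr (_ * _).
elim: w bw => [|b w IH] bw; first by rewrite !big_nil rmorph1.
rewrite !big_cons /= rmorphM Psi_rep ?IH //; last by apply: bw; rewrite mem_head.
by move=> b' b'w; apply: bw; rewrite inE b'w orbT.
Qed.
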